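(* For every left group-$e$-semigroup $(G,\cdot,e,\odot)$ the following are equivalent: (a) $(G,\cdot,e,\odot)$ is a left group-$e$-grouplike, i.e. $(G,\odot)$ is a grouplike; (b) $e\odot e$ is an identity for the semigroup $Zt(G,\odot)$ (in particular $e\odot e\in Zt(G,\odot)$); (c) $Zt(G,\odot)=\{e\odot e\}$. Also, there is a group-$e$-homogroup that is not a group-$e$-grouplike.
   Context: A left group-$e$-semigroup $(G,\cdot,e,\odot)$ consists of a group $(G,\cdot)$ with identity element $e$ and a semigroup $(G,\odot)$ on the same set such that the left $e$-join law $e\odot(xy)=e\odot(x\odot y)$ holds for all $x,y\in G$ (where $xy=x\cdot y$). A group-$e$-semigroup is a left group-$e$-semigroup which also satisfies the right $e$-join law $(xy)\odot e=(x\odot y)\odot e$ for all $x,y\in G$. $Zt(G,\odot)$ is the set of central idempotents of $(G,\odot)$. A homogroup is a semigroup containing an ideal subgroup (a two-sided ideal that is a group under the restricted operation). A grouplike is a homogroup whose set of central idempotents is a singleton. A group-$e$-homogroup (resp. group-$e$-grouplike) is a group-$e$-semigroup for which $(G,\odot)$ is a homogroup (resp. a grouplike); a left group-$e$-grouplike is a left group-$e$-semigroup for which $(G,\odot)$ is a grouplike. *)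

(* Defs.v *)
From mathcomp Require Export all_boot.
From mathcomp Require Export boolp classical_sets.

Set Implicit Arguments.
Unset Strict Implicit.
Unset Printing Implicit Defensive.

Local Open Scope classical_set_scope.

Section Semigroups.
Variables (T : Type) (op : T -> T -> T).

Definition central_idempotents : set T :=
  [set z | op z z = z /\ forall x, op z x = op x z].

Definition is_ideal (K : set T) : Prop :=
  K !=set0 /\ forall k x, K k -> K (op k x) /\ K (op x k).

(* Associativity of the restricted operation is inherited from [op], so it is
   not repeated here. *)
Definition is_subgroup (K : set T) : Prop :=
  (forall x y, K x -> K y -> K (op x y)) /\
  exists u, [/\ K u,
    forall x, K x -> op u x = x /\ op x u = x &
    forall x, K x -> exists y, [/\ K y, op x y = u & op y x = u]].

Definition is_identity_of (A : set T) (u : T) : Prop :=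
  A u /\ forall x, A x -> op u x = x /\ op x u = x.

Definition homogroup : Prop :=
  associative op /\ exists K : set T, is_ideal K /\ is_subgroup K.

Definition grouplike : Prop :=
  homogroup /\ exists z, central_idempotents = [set z].

End Semigroups.

(* The group multiplication is the canonical one of [G : groupType], [e] is its
   unit [1%g], and [op] is the second operation. *)
Section GroupESemigroups.
Variables (G : groupType) (op : G -> G -> G).

Definition left_group_e_semigroup : Prop :=
  associative op /\ forall x y : G, op 1%g (x * y)%g = op 1%g (op x y).

Definition group_e_semigroup : Prop :=
  left_group_e_semigroup /\ forall x y : G, op (x * y)%g 1%g = op (op x y) 1%g.

Definition left_group_e_grouplike : Prop :=
  left_group_e_semigroup /\ grouplike op.

Definition group_e_homogroup : Prop := group_e_semigroup /\ homogroup op.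

Definition group_e_grouplike : Prop := group_e_semigroup /\ grouplike op.

End GroupESemigroups.

(* Main.v *)
Require Import Defs.
From mathcomp Require Import all_boot.
From mathcomp Require Import boolp classical_sets.
From mathcomp Require Import zmodp.

(** Write [a = e ⊙ e].  The join law gives [a ⊙ x ⊙ x^-1 = a] for every [x], so
    [a] lies in every ideal and [a ⊙ G] is a group with unit [a].  If [K] is an
    ideal subgroup, the idempotent [a] of [K] is then its unit, which is central.
    If conversely [a] is central, then [a ⊙ G] is an ideal subgroup.  Finally
    [a ⊙ z = a] for every idempotent [z] commuting with [a], so the unit of [Zt]
    can only be [a] if [Zt = {a}].  The counterexample is a nontrivial group
    turned into a commutative semigroup with zero [e] and one more idempotent. *)

Local Open Scope classical_set_scope.

(** Both [u ⊙ x] and [x ⊙ u] lie in [K], where [u] acts as an identity, so each equals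
    [u ⊙ x ⊙ u]. *)
Lemma ideal_subgroup_unit_central {T : Type} {op : T -> T -> T} {K : set T}
    {u : T} :
  associative op -> is_ideal op K -> K u ->
  (forall x, K x -> op u x = x /\ op x u = x) ->
  forall x, op u x = op x u.
Proof.
move=> opA [_ idK] Ku unitu x.
have [Kux Kxu] := idK u x Ku.
by rewrite -(unitu _ Kux).2 -opA (unitu _ Kxu).1.
Qed.

(** For an inverse [y] of [a] in [K], [a = a ⊙ u = a ⊙ a ⊙ y = a ⊙ y = u]. *)
Lemma subgroup_idempotent {T : Type} {op : T -> T -> T} {K : set T} {u a : T} :
  associative op -> K a ->
  (forall x, K x -> op u x = x /\ op x u = x) ->
  (forall x, K x -> exists y, [/\ K y, op x y = u & op y x = u]) ->
  op a a = a -> a = u.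
Proof.
move=> opA Ka unitu inv aa.
have [y [_ ay _]] := inv a Ka.
by rewrite -[LHS](unitu a Ka).2 -ay opA aa.
Qed.

Section LeftGroupESemigroup.
Variables (G : groupType) (op : G -> G -> G).
Hypothesis opG : left_group_e_semigroup op.
Local Notation a := (op 1%g 1%g).

Lemma join_idem_mul x : op a x = op 1%g x.
Proof. by rewrite -opG.1 -opG.2 mul1g. Qed.

Lemma join_idemr x : op (op 1%g x) 1%g = op 1%g x.
Proof. by rewrite -opG.1 -opG.2 mulg1. Qed.

Lemma join_idem_idem : op a a = a.
Proof. by rewrite join_idem_mul opG.1 join_idemr. Qed.

Lemma join_idem_inv x : op (op a x) x^-1%g = a.
Proof. by rewrite join_idem_mul -opG.1 -opG.2 mulgV. Qed.

Lemma join_idem_ideal {K : set G} : is_ideal op K -> K a.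
Proof.
move=> [[k Kk] idK]; rewrite -(join_idem_inv k).
by apply: (idK _ _ _).1; apply: (idK _ _ _).2.
Qed.

(** Substituting [a = a ⊙ z ⊙ z^-1] in [z ⊙ a] creates a second factor [z], which commutes past [a]
    and merges with the first; what is left is [a ⊙ z ⊙ z^-1 = a]. *)
Lemma join_idem_absorb z : central_idempotents op z -> op a z = a.
Proof.
move=> [zz cz]; rewrite -cz -{1}(join_idem_inv z) -(cz a).
by rewrite (opG.1 z) (opG.1 z z) zz cz join_idem_inv.
Qed.

Lemma homogroup_join_idem_central :
  homogroup op -> central_idempotents op a.
Proof.
move=> [opA [K [idK [_ [u [Ku unitu inv]]]]]].
have au := subgroup_idempotent opA (join_idem_ideal idK) unitu inv join_idem_idem.
split=> [|x]; first exact: join_idem_idem.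
by rewrite au; apply: ideal_subgroup_unit_central idK Ku unitu x.
Qed.

Lemma join_idem_central_homogroup :
  central_idempotents op a -> homogroup op.
Proof.
move=> [aa ca]; split; first exact: opG.1.
exists (range (op a)); split.
  split; first by exists a, a.
  move=> _ x [k _ <-]; split; first by exists (op k x); rewrite ?opG.1.
  by exists (op x k) => //; rewrite opG.1 ca -opG.1.
split.
  by move=> _ y [k _ <-] _; exists (op k y); rewrite ?opG.1.
exists a; split; first by exists a.
  by move=> _ [k _ <-]; rewrite -(ca (op a k)) (opG.1 a) aa.
(* As [a] is central and idempotent, the inner [a] merges into the outer one. *)
have mulaa x y : op (op a x) (op a y) = op (op a x) y.
  by rewrite (opG.1 (op a x)) -(ca (op a x)) (opG.1 a) aa.
(* The inverse of [a ⊙ k] comes from the group inverse of [k]. *)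
move=> _ [k _ <-]; exists (op a k^-1%g); rewrite !mulaa join_idem_inv.
by split; [exists k^-1%g| |rewrite -{2}(invgK k) join_idem_inv].
Qed.

Lemma join_idem_identity_singleton :
  is_identity_of op (central_idempotents op) a <->
  central_idempotents op = [set a].
Proof.
split=> [[Za ida]|Zt].
  apply/seteqP; split=> [z Zz|_ ->//].
  by rewrite /= -(ida z Zz).1 join_idem_absorb.
by rewrite Zt; split=> // _ ->; rewrite join_idem_idem.
Qed.

Lemma left_group_e_grouplike_singleton :
  left_group_e_grouplike op <-> central_idempotents op = [set a].
Proof.
split=> [[_ [hom [z Zt]]]|Zt].
  by have := homogroup_join_idem_central hom; rewrite Zt => ->.
split=> //; split; last by exists a.
by apply: join_idem_central_homogroup; rewrite Zt.
Qed.

End LeftGroupESemigroup.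

Lemma group_e_homogroup_not_grouplike (G : groupType) (g : G) : g != 1%g ->
  exists op : G -> G -> G, group_e_homogroup op /\ ~ group_e_grouplike op.
Proof.
move=> g1; have eg : (1%g == g) = false by rewrite eq_sym (negbTE g1).
pose op (x y : G) : G := if (x == g) && (y == g) then g else 1%g.
have opE x y : (op x y == g) = (x == g) && (y == g).
  by rewrite /op; case: ifP; rewrite ?eqxx.
have opA : associative op.
  (* Both bracketings are [g] exactly when all three factors are, and [1%g] otherwise. *)
  by move=> x y z; rewrite {1}/op {2}/op !opE andbA.
have op1x x : op 1%g x = 1%g by rewrite /op eg.
have opx1 x : op x 1%g = 1%g by rewrite /op eg andbF.
have opC x y : op x y = op y x by rewrite /op andbC.
have opG : left_group_e_semigroup op by split=> // x y; rewrite !op1x.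
have Z1 : central_idempotents op 1%g by split=> *; rewrite op1x ?opx1.
have Zg : central_idempotents op g by split=> *; rewrite // /op eqxx.
exists op; split.
  split; first by split=> // x y; rewrite !opx1.
  (* Here [e ⊙ e] is the zero [e], hence central; the resulting ideal subgroup is [{e}]. *)
  by apply: join_idem_central_homogroup; rewrite ?op1x.
by move=> [_ [_ [z Zt]]]; move: Z1 Zg g1; rewrite Zt /= => -> ->; rewrite eqxx.
Qed.

Theorem corollary2p4 :
  (forall (G : groupType) (op : G -> G -> G), left_group_e_semigroup op ->
     (left_group_e_grouplike op <->
      is_identity_of op (central_idempotents op) (op 1%g 1%g)) /\
     (is_identity_of op (central_idempotents op) (op 1%g 1%g) <->
      central_idempotents op = [set op 1%g 1%g])) /\
  (exists (G : groupType) (op : G -> G -> G),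
     group_e_homogroup op /\ ~ group_e_grouplike op).
Proof.
split=> [G op opG|].
  have bc := join_idem_identity_singleton _ _ opG.
  split; last exact: bc.
  by rewrite bc; apply: left_group_e_grouplike_singleton.
(* The group law on ['I_2] is addition modulo 2: [1%g] is the residue 0 and [ord_max] the residue
   1. *)
by exists 'I_2; apply: (@group_e_homogroup_not_grouplike _ ord_max).
Qed.
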